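(* Let $\kappa$ be a cardinal with $\kappa^{<\kappa}=\kappa$, let $\mathcal L$ be a relational language of size $\le\kappa$, and let $\mathcal K\subseteq\mathrm{Mod}^\kappa_{\mathcal L}$ be an invariant set. If $\mathrm{rk}_B(\cong^\kappa_{\mathcal K})\neq\infty$, then for all $\mathcal M,\mathcal N\in\mathcal K$: $\mathcal M\cong\mathcal N$ if and only if player II has a winning strategy in $\mathrm{EF}^\kappa_{\delta}(\mathcal M,\mathcal N)$, where $\delta=\max\{\mathrm{rk}_B(\cong^\kappa_{\mathcal K}),1\}$.
   Context: ${}^\kappa\kappa$ has the bounded topology (basic sets $N_p=\{x:p\subseteq x\}$, $p\in{}^{<\kappa}\kappa$). Borel classes on a space $X$ homeomorphic to a subspace of ${}^\kappa\kappa$: $\boldsymbol\Sigma^0_1$ open, $\boldsymbol\Pi^0_1$ closed, $\boldsymbol\Sigma^0_\alpha$ ($\alpha\ge2$) = $\kappa$-unions of sets in $\bigcup_{1\le\beta<\alpha}\boldsymbol\Pi^0_\beta$, $\boldsymbol\Pi^0_\alpha$ = complements. $\mathrm{rk}_B(A)=0$ if $A$ clopen, else least $\alpha\ge1$ with $A\in\boldsymbol\Sigma^0_\alpha\cup\boldsymbol\Pi^0_\alpha$; $\infty$ if $A$ is not in the $\kappa^+$-algebra generated by the open sets. $\mathrm{Mod}^\kappa_{\mathcal L}$ = $\mathcal L$-structures with domain $\kappa$, topology generated by $N_{\mathcal Q}=\{\mathcal M:\mathcal Q$ substructure of the $\mathcal L'$-reduct of $\mathcal M\}$ ($\mathcal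 L'\subseteq\mathcal L$, $|\mathcal L'|<\kappa$, $\mathcal Q$ an $\mathcal L'$-structure with domain bounded in $\kappa$). Invariant = closed under isomorphism. $\cong^\kappa_{\mathcal K}$ is the isomorphism relation on $\mathcal K$ as a subset of $\mathcal K\times\mathcal K$, whose rank is computed in $\mathcal K\times\mathcal K$. Trees: a tree is a partial order with a unique minimal element (root) in which the predecessors of each node form a finite linear order; it is well-founded if it has no infinite chain. $\mathrm{Tr}_\alpha$ is the tree of strictly decreasing finite sequences of ordinals $<\alpha$, ordered by end-extension. EF game $\mathrm{EF}^\kappa_{\mathrm{Tr}}(\mathcal M,\mathcal N)$ for a well-founded tree $\mathrm{Tr}$ of size $\le\kappa$: at round $n$, player I picks a node $p_n$ that is an immediate successor of $p_{n-1}$ (of the root if $n=0$) and a set $C_n\subseteq\kappa$ with $|C_n|<\kappa$ and $C_n\supseteq C_i$ for $i<n$; player II picks a partial function $f_n:\kappa\to\kappa$ with $|\mathrm{dom}(f_n)|<\kappa$, $\mathrm{dom}(f_n)\cap\mathrm{ran}(f_n)\supseteq C_n$, $f_n\supseteq f_i$ for $i<n$. The game ends when I cannot move (the last node is a leaf, or the root is a leaf); II wins iff $\bigcup_i f_i$ is a partial isomorphism from $\mathcal M$ to $\mathcal N$. $\mathrm{EF}^\kappa_\alpha=\mathrm{EF}^\kappa_{\mathrm{Tr}_\alpha}$. *)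

(* Defs.v *)
From HB Require Import structures.
From mathcomp Require Import all_boot all_classical.
From mathcomp Require Import topology_structure initial_topology.
From mathcomp Require Import product_topology subtype_topology.
From mathcomp Require Import wochoice.

Set Implicit Arguments.
Unset Strict Implicit.
Unset Printing Implicit Defensive.

Local Open Scope classical_set_scope.
Local Open Scope card_scope.

(* An ordinal is represented by a well-ordered type, whose elements stand for
   the smaller ordinals. Equality of ordinals is [ordt_eq] below. *)
Record ordType := OrdType {
  osort :> Type;
  wle : rel osort;
  wleP : well_order wle
}.

Definition wlt (a : ordType) (x y : a) := ~~ wle y x.

Lemma wle_anti (a : ordType) : antisymmetric (@wle a).
Proof.
move=> x y /andP[xy yx].
have refl (u : a) : wle u u.
  have [|z [[/asboolP-> /(_ u)/=-> //]]] := @wleP a [pred v | `[< v = u >]].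
    by exists u; apply/asboolP.
  exact/asboolP.
have [|z [_ zu]] := @wleP a [pred u | `[< u = x \/ u = y >]].
  by exists x; apply/asboolP; left.
rewrite -(zu x) ?(zu y)//; split; first by [apply/asboolP; right].
- by move=> v /asboolP[]->.
- by apply/asboolP; left.
- by move=> v /asboolP[]->.
Qed.

Definition seg_le (a : ordType) (x : a) : rel {y : a | wlt y x} :=
  fun u v => wle (val u) (val v).

Lemma seg_wo (a : ordType) (x : a) : well_order (@seg_le a x).
Proof.
apply: antisymmetric_well_order => [u v /wle_anti/val_inj//|A [u Au]].
have [|z [[/asboolP[w Aw <-] lbz] _]] :=
  @wleP a [pred y | `[< exists2 v, v \in A & val v = y >]].
  by exists (val u); apply/asboolP; exists u.
by exists w; split=> // v Av; apply: lbz; apply/asboolP; exists v.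
Qed.

(* The ordinal represented by the element [x] of [a]. *)
Definition oseg (a : ordType) (x : a) : ordType := OrdType (@seg_wo a x).

Lemma fin_wo (n : nat) : well_order (fun i j : 'I_n => (i <= j)%N).
Proof.
apply: antisymmetric_well_order => [i j|A [i Ai]].
  by rewrite -eqn_leq => /eqP/val_inj.
by have [j Aj lbj] := arg_minnP (fun k : 'I_n => val k) Ai; exists j.
Qed.

Definition ofin (n : nat) : ordType := OrdType (@fin_wo n).

Definition ordt_eq (a b : ordType) :=
  exists2 f : a -> b, bijective f & forall x y, wle (f x) (f y) = wle x y.
Definition ordt_lt (a b : ordType) := exists y : b, ordt_eq a (oseg y).
Definition ordt_le (a b : ordType) := ordt_lt a b \/ ordt_eq a b.
Definition ordt_max (a b : ordType) := if `[< ordt_le a b >] then b else a.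

Definition card_lt T U (A : set T) (B : set U) : Prop :=
  (A #<= B) /\ ~ (B #<= A).

Definition infinite_cardinal (kappa : ordType) :=
  infinite_set [set: kappa] /\
  forall x : kappa, card_lt [set: oseg x] [set: kappa].

(* The set ^{<kappa}kappa: lengths are the ordinals represented by the elements
   of [kappa]. *)
Definition short_seq (kappa : ordType) := {x : kappa & oseg x -> kappa}.

Section Borel.
Variables (kappa : ordType) (T : topologicalType).
Implicit Types (a : ordType) (A : set T).

Inductive Sigma0 : ordType -> set T -> Prop :=
| Sigma0_open a A : ordt_eq a (ofin 1) -> open A -> Sigma0 a A
| Sigma0_bigcup a (b : kappa -> ordType) (B : kappa -> set T) :
    ordt_le (ofin 2) a ->
    (forall i, ordt_le (ofin 1) (b i) /\ ordt_lt (b i) a) ->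
    (forall i, Sigma0 (b i) (~` B i)) ->
    Sigma0 a (\bigcup_i B i).

Definition Pi0 a A := Sigma0 a (~` A).

Definition kappa_algebra (S : set_system T) :=
  (forall A, S A -> S (~` A)) /\
  (forall F : kappa -> set T, (forall i, S (F i)) -> S (\bigcup_i F i)).

Definition kappa_borel : set_system T := smallest kappa_algebra open.

Definition borel_level A a := ordt_le (ofin 1) a /\ (Sigma0 a A \/ Pi0 a A).

Definition is_rank A a :=
  (clopen A -> ordt_eq a (ofin 0)) /\
  (~ clopen A -> borel_level A a /\ forall b, borel_level A b -> ordt_le a b).

End Borel.

Variant brank := Rank of ordType | Infty.

(* [ofin 0] in the inner match is a placeholder: a kappa-Borel set always
   has a rank when [kappa] is an infinite cardinal. *)
Definition rk_B (kappa : ordType) (T : topologicalType) (A : set T) : brank :=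
  if `[< kappa_borel kappa A >] then
    Rank (match pselect (exists a, is_rank kappa A a) with
          | left h => projT1 (cid h)
          | right _ => ofin 0
          end)
  else Infty.

Record language := Language { symbol :> Type; arity : symbol -> nat }.

Definition structure (L : language) (X : Type) :=
  forall R : L, set ('I_(arity R) -> X).

Definition sublang (L : language) (L' : set L) : language :=
  @Language L' (fun R => arity (val R)).

Definition reduct (L : language) (L' : set L) X (M : structure L X) :
  structure (sublang L') X := fun R => M (val R).

Definition substructure (L : language) X (D : set X)
    (Q : structure L D) (M : structure L X) :=
  forall (R : L) (t : 'I_(arity R) -> D), Q R t <-> M R (val \o t).

Definition isomorphic (L : language) X Y
    (M : structure L X) (N : structure L Y) :=
  exists2 f : X -> Y, bijective f &
    forall (R : L) (t : 'I_(arity R) -> X), M R t <-> N R (f \o t).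

Definition Mod (kappa : ordType) (L : language) : Type := structure L kappa.

Section ModTopology.
Variables (kappa : ordType) (L : language).

Definition bounded_set (D : set kappa) := exists x, D `<=` [set y | wlt y x].

Definition basic_nbhd (L' : set L) (D : set kappa)
    (Q : structure (sublang L') D) : set (Mod kappa L) :=
  [set M | substructure Q (reduct M)].

Definition Mod_subbase : set_system (Mod kappa L) :=
  [set U | exists (L' : set L) (D : set kappa)
      (Q : structure (sublang L') D),
    [/\ card_lt L' [set: kappa], bounded_set D & U = basic_nbhd Q]].

HB.instance Definition _ := gen_eqMixin (Mod kappa L).
HB.instance Definition _ := gen_choiceMixin (Mod kappa L).
HB.instance Definition _ :=
  @isSubBaseTopological.Build (Mod kappa L) (set (Mod kappa L)) Mod_subbase id.

End ModTopology.

Definition iso_invariant (kappa : ordType) (L : language)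
    (K : set (Mod kappa L)) :=
  forall M N : Mod kappa L, isomorphic M N -> K M -> K N.

(* [set_type K] carries the subspace topology, and not the topology of
   [subspace K], which lives on the whole of [Mod kappa L]. *)
Definition iso_rel (kappa : ordType) (L : language) (K : set (Mod kappa L)) :
    set (set_type K * set_type K) :=
  [set p | isomorphic (set_val p.1) (set_val p.2)].

Arguments iso_rel {kappa L} K.

Record wf_tree := WfTree {
  node :> Type;
  tle : node -> node -> Prop;
  tle_refl : forall p, tle p p;
  tle_trans : forall p q r, tle p q -> tle q r -> tle p r;
  tle_anti : forall p q, tle p q -> tle q p -> p = q;
  troot : node;
  troot_min : forall p, tle p troot -> p = troot;
  troot_uniq : forall m, (forall p, tle p m -> p = m) -> m = troot;
  tpred_finite : forall p, finite_set [set q | tle q p /\ q <> p];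
  tpred_total : forall p, total_on [set q | tle q p /\ q <> p] tle;
  tle_wf : forall C : set node, total_on C tle -> finite_set C
}.

Definition tlt (t : wf_tree) (p q : t) := tle p q /\ p <> q.
Definition tsucc (t : wf_tree) (p q : t) :=
  tlt p q /\ ~ exists r, tlt p r /\ tlt r q.
Definition leaf (t : wf_tree) (p : t) := ~ exists q, tsucc p q.

Section DecreasingSequences.
Variable a : ordType.

Definition dseq := {s : seq a | sorted (fun x y => wlt y x) s}.

Definition dseq_le (s t : dseq) := exists u, val t = val s ++ u.

Definition dseq_nil : dseq := exist _ [::] isT.

Lemma dseq_refl s : dseq_le s s.
Proof. by exists [::]; rewrite cats0. Qed.

Lemma dseq_trans s t u : dseq_le s t -> dseq_le t u -> dseq_le s u.
Proof. by move=> [v tE] [w uE]; exists (v ++ w); rewrite uE tE catA. Qed.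

Lemma dseq_le_size s t : dseq_le s t -> size (val t) = size (val s) -> s = t.
Proof.
move=> [u tE]; rewrite tE size_cat -[RHS]addn0 => /addnI/size0nil u0.
by apply: val_inj; rewrite tE u0 cats0.
Qed.

Lemma dseq_anti s t : dseq_le s t -> dseq_le t s -> s = t.
Proof.
move=> st [v sE]; apply: (dseq_le_size st); apply/eqP.
by case: st => u tE; rewrite eqn_leq {1}sE tE !size_cat !leq_addr.
Qed.

Lemma dseq_nil_le s : dseq_le dseq_nil s.
Proof. by exists (val s). Qed.

Lemma dseq_nil_min s : dseq_le s dseq_nil -> s = dseq_nil.
Proof. by move=> /dseq_anti; apply; exact: dseq_nil_le. Qed.

Lemma dseq_nil_uniq m : (forall s, dseq_le s m -> s = m) -> m = dseq_nil.
Proof. by move=> /(_ _ (dseq_nil_le m)). Qed.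

Lemma dseq_pred_chain s : total_on [set t | dseq_le t s /\ t <> s] dseq_le.
Proof.
have takeE t : dseq_le t s -> val t = take (size (val t)) (val s).
  by case=> u ->; rewrite take_size_cat.
move=> t u [/takeE tE _] [/takeE uE _].
have [tu|/ltnW ut] := leqP (size (val t)) (size (val u)).
  left; exists (drop (size (val t)) (val u)).
  by rewrite {1}tE -(take_takel _ tu) -uE cat_take_drop.
right; exists (drop (size (val u)) (val t)).
by rewrite {1}uE -(take_takel _ ut) -tE cat_take_drop.
Qed.

Lemma dseq_chain_bounded (C : set dseq) n : total_on C dseq_le ->
  (forall s, C s -> (size (val s) <= n)%N) -> finite_set C.
Proof.
move=> totC leC.
have inj : {in C &, injective (fun s : dseq => size (val s))}.
  move=> s t /set_mem Cs /set_mem Ct st.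
  have [/dseq_le_size->//|/dseq_le_size->//] := totC _ _ Cs Ct.
rewrite -(eq_finite_set (inj_card_eq inj)).
apply: (@sub_finite_set _ _ `I_n.+1); last exact: finite_II.
by move=> _ [s Cs <-] /=; rewrite ltnS; exact: leC.
Qed.

Lemma dseq_chain_finite (C : set dseq) : total_on C dseq_le -> finite_set C.
Proof.
move=> totC; apply: contrapT => infC.
have big n : exists2 s, C s & (n < size (val s))%N.
  apply: contrapT => nb; apply: infC; apply: (dseq_chain_bounded (n := n) totC).
  by move=> s Cs; rewrite leqNgt; apply/negP => ns; apply: nb; exists s.
have [[[//|x0 s0] ss0] _ _] := big 0%N.
pose P x := exists n s, [/\ C s, (n < size (val s))%N & nth x0 (val s) n = x].
have [|z [[/asboolP[n [s [Cs ns sn]]] lbz] _]] := @wleP a [pred x | `[< P x >]].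
  have [s Cs s_gt] := big 0%N.
  by exists (nth x0 (val s) 0); apply/asboolP; exists 0%N, s.
have [t Ct nt] := big n.+1.
have : nth x0 (val t) n = z.
  by case: (totC _ _ Cs Ct) sn => -[u ->]; rewrite nth_cat ?ns ?(ltnW nt).
have : wle z (nth x0 (val t) n.+1).
  by apply: lbz; apply/asboolP; exists n.+1, t.
have /(sortedP x0)/(_ n nt) := valP t.
by rewrite /wlt => /negP + + tn; rewrite tn.
Qed.

Lemma dseq_pred_finite s : finite_set [set t | dseq_le t s /\ t <> s].
Proof. exact/dseq_chain_finite/dseq_pred_chain. Qed.

Definition Tr : wf_tree := WfTree dseq_refl dseq_trans dseq_anti
  dseq_nil_min dseq_nil_uniq dseq_pred_finite dseq_pred_chain
  dseq_chain_finite.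

End DecreasingSequences.

(* Partial functions are given by their graphs. *)
Definition functional X Y (f : set (X * Y)) :=
  forall x y y', f (x, y) -> f (x, y') -> y = y'.
Definition gdom X Y (f : set (X * Y)) : set X := fst @` f.
Definition gran X Y (f : set (X * Y)) : set Y := snd @` f.

Definition partial_isomorphism (L : language) X Y
    (M : structure L X) (N : structure L Y) (f : set (X * Y)) :=
  [/\ functional f,
      forall x x' y, f (x, y) -> f (x', y) -> x = x'
    & forall (R : L) (t : 'I_(arity R) -> X) (u : 'I_(arity R) -> Y),
        (forall j, f (t j, u j)) -> (M R t <-> N R u)].

Section EhrenfeuchtFraisse.
Variables (kappa : ordType) (L : language) (t : wf_tree).
Variables M N : Mod kappa L.

(* A run is recorded by the sequence of the moves of player I; a strategy of
   player II maps each nonempty such sequence to II's answer to its last move. *)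
Definition moveI := (node t * set kappa)%type.
Definition strategyII := seq moveI -> set (kappa * kappa).

Definition nthI (s : seq moveI) (n : nat) : moveI := nth (troot t, set0) s n.

Definition legalI (s : seq moveI) := forall n, (n < size s)%N ->
  [/\ tsucc (if n is m.+1 then (nthI s m).1 else troot t) (nthI s n).1,
      card_lt (nthI s n).2 [set: kappa]
    & forall i, (i < n)%N -> (nthI s i).2 `<=` (nthI s n).2].

Definition answer (sigma : strategyII) (s : seq moveI) (n : nat) :=
  sigma (take n.+1 s).

Definition legalII (sigma : strategyII) (s : seq moveI) :=
  forall n, (n < size s)%N ->
  [/\ functional (answer sigma s n),
      card_lt (gdom (answer sigma s n)) [set: kappa],
      (nthI s n).2 `<=` gdom (answer sigma s n) `&` gran (answer sigma s n)
    & forall i, (i < n)%N -> answer sigma s i `<=` answer sigma s n].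

Definition game_over (s : seq moveI) := leaf (last (troot t) (map fst s)).

Definition winningII (sigma : strategyII) := forall s, legalI s ->
  legalII sigma s /\
  (game_over s -> partial_isomorphism M N
     (\bigcup_(n in [set n | (n < size s)%N]) answer sigma s n)).

Definition II_wins_EF := exists sigma, winningII sigma.

End EhrenfeuchtFraisse.

Arguments II_wins_EF {kappa L} t M N.

(* Main.v *)
(* The equivalence classes of isomorphism are the sections of a Borel set, hence
   Borel of the same level. Let comeagerly many bijections [h] of [kappa] act on
   a structure [M], and say that a partial injection [p] of size less than [kappa]
   forces a set [A] at [M] if [h] sends [M] into [A] for comeagerly many [h]
   extending [p]. If II wins the game of rank [a] from [M] to [N] after having
   built [f], then [p] forces a [Pi0 a] set at [M] only if [f \o p] forces it at
   [N]: one round of the game pulls an extension of [f \o p] deciding otherwise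
   back to an extension of [p]. As [kappa] is regular, a Baire category theorem
   holds, so for invariant sets being forced by the empty function at [M] and
   containing [M] coincide; hence no class contains just one of [M] and [N]. *)

Require Import Defs.
From mathcomp Require Import all_boot all_classical.
From mathcomp Require Import topology_structure initial_topology.
From mathcomp Require Import product_topology subtype_topology.
From mathcomp Require Import wochoice.

Set Implicit Arguments.
Unset Strict Implicit.
Unset Printing Implicit Defensive.

Local Open Scope classical_set_scope.
Local Open Scope card_scope.

(** * Ordinals *)

Section WellOrder.
Variable a : ordType.
Implicit Types x y z : a.

Lemma wo_least (P : a -> Prop) :
  (exists x, P x) -> exists2 x, P x & forall y, P y -> wle x y.
Proof.
case=> x Px; have [|z [[/asboolP Pz lbz] _]] := @wleP a [pred y | `[< P y >]].
  by exists x; apply/asboolP.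
by exists z => // y Py; apply/lbz/asboolP.
Qed.

Lemma wle_total x y : wle x y || wle y x.
Proof.
have [|z [->|->] H] := @wo_least (fun z => z = x \/ z = y).
- by exists x; left.
- by rewrite (H y) //; right.
- by rewrite (H x) ?orbT//; left.
Qed.

Lemma wlexx x : wle x x.
Proof. by have := wle_total x x; rewrite orbb. Qed.

Lemma wle_trans y x z : wle x y -> wle y z -> wle x z.
Proof.
have [|u [->|[->|->]] H] := @wo_least (fun u => u = x \/ u = y \/ u = z).
- by exists x; left.
- by move=> *; apply: H; right; right.
- move=> xy yz; have yx : wle y x by apply: H; left.
  by rewrite (@wle_anti a x y) ?xy ?yx.
- move=> xy yz; have zy : wle z y by apply: H; right; left.
  by rewrite (@wle_anti a z y) ?yz ?zy.
Qed.

Lemma wltW x y : wlt x y -> wle x y.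
Proof.
by rewrite /wlt => nyx; have := wle_total x y; rewrite (negPf nyx) orbF.
Qed.

Lemma wle_lt_trans y x z : wle x y -> wlt y z -> wlt x z.
Proof. by move=> xy; apply: contra => /wle_trans; apply. Qed.

Lemma wlt_trans y x z : wlt x y -> wlt y z -> wlt x z.
Proof. by move=> /wltW; apply: wle_lt_trans. Qed.

Lemma wlt_total x y : [\/ wlt x y, x = y | wlt y x].
Proof.
have [yx|xy] := boolP (wle y x); last by apply: Or31.
have [xy|] := boolP (wle x y); last by move=> ?; apply: Or33.
by apply/Or32/wle_anti; rewrite xy yx.
Qed.

Lemma wlt_wf : well_founded (fun x y => wlt x y).
Proof.
move=> x; apply: contrapT => nx.
have [|y nAy lby] := @wo_least (fun y => ~ Acc (fun u v => wlt u v) y).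
  by exists x.
apply: nAy; constructor => z zy; apply: contrapT => /lby.
by apply/negP.
Qed.

Lemma wlt_ind (P : a -> Prop) :
  (forall x, (forall y, wlt y x -> P y) -> P x) -> forall x, P x.
Proof. by move=> IH x; elim: (wlt_wf x) => y _; apply: IH. Qed.

(** Otherwise take the least [y] with [f y] below [y]: then [f y] is a smaller such point. *)
Lemma wle_increasing (f : a -> a) :
  {homo f : x y / wlt x y} -> forall x, wle x (f x).
Proof.
move=> fi x; apply: contrapT => /negP nx.
have [|y fy lby] := @wo_least (fun y => wlt (f y) y); first by exists x.
by have := lby _ (fi _ _ fy); apply/negP.
Qed.

End WellOrder.

Section OrdinalComparison.
Implicit Types a b c : ordType.

Lemma ordt_eq_refl a : ordt_eq a a.
Proof. by exists id => //; exists id. Qed.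

Lemma ordt_eq_sym a b : ordt_eq a b -> ordt_eq b a.
Proof.
case=> f [g fK gK] fle; exists g; first by exists f.
by move=> x y; rewrite -fle !gK.
Qed.

Lemma ordt_eq_trans b a c : ordt_eq a b -> ordt_eq b c -> ordt_eq a c.
Proof.
case=> f bf fle [g bg gle]; exists (g \o f); first exact: bij_comp.
by move=> x y; rewrite /= gle fle.
Qed.

Lemma ordt_eq_oseg a b (f : a -> b) x : bijective f ->
  (forall x y, wle (f x) (f y) = wle x y) -> ordt_eq (oseg x) (oseg (f x)).
Proof.
case=> g fK gK fle.
have fP (u : oseg x) : wlt (f (val u)) (f x).
  by rewrite /wlt fle; exact: valP u.
have gP (u : oseg (f x)) : wlt (g (val u)) x.
  by have := valP u; rewrite /wlt -{1}[val u]gK fle.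
exists (fun u => exist _ (f (val u)) (fP u)); last first.
  by move=> u v; rewrite /= /seg_le /= fle.
exists (fun u => exist _ (g (val u)) (gP u)) => u; apply: val_inj => /=.
  exact: fK.
exact: gK.
Qed.

Lemma ordt_eq_oseg2 a (x : a) (y : oseg x) : ordt_eq (oseg y) (oseg (val y)).
Proof.
have fP (u : oseg y) : wlt (val (val u)) (val y) by exact: valP u.
have gP1 (u : oseg (val y)) : wlt (val u) x.
  exact: wlt_trans (valP u) (valP y).
have gP (u : oseg (val y)) : @wlt (oseg x) (exist _ (val u) (gP1 u)) y.
  exact: valP u.
exists (fun u => exist _ (val (val u)) (fP u)) => //.
exists (fun u => exist (fun v => wlt v y) (exist _ (val u) (gP1 u)) (gP u)) => u.
  by apply/val_inj/val_inj.
exact: val_inj.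
Qed.

Lemma oseg_lt a (x : a) : ordt_lt (oseg x) a.
Proof. by exists x; exact: ordt_eq_refl. Qed.

Lemma oseg_ltP a (x y : a) : wlt x y -> ordt_lt (oseg x) (oseg y).
Proof. by move=> xy; exists (exist _ x xy); exact/ordt_eq_sym/ordt_eq_oseg2. Qed.

Lemma ordt_lt_eql b a c : ordt_eq a b -> ordt_lt b c -> ordt_lt a c.
Proof. by move=> ab [y /(ordt_eq_trans ab)]; exists y. Qed.

Lemma ordt_lt_eqr b a c : ordt_lt a b -> ordt_eq b c -> ordt_lt a c.
Proof.
move=> [y ay] [f bf fle]; exists (f y).
exact/(ordt_eq_trans ay)/ordt_eq_oseg.
Qed.

Lemma ordt_lt_oseg a b (x : a) : ordt_lt b (oseg x) ->
  exists2 y, wlt y x & ordt_eq b (oseg y).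
Proof.
move=> [y by_]; exists (val y); first exact: valP y.
exact/(ordt_eq_trans by_)/ordt_eq_oseg2.
Qed.

Lemma ordt_lt_trans b a c : ordt_lt a b -> ordt_lt b c -> ordt_lt a c.
Proof.
move=> ab [y by_]; have [z _ az] := ordt_lt_oseg (ordt_lt_eqr ab by_).
by exists z.
Qed.

(** An isomorphism of [a] onto a proper segment would be an increasing self-map of [a] that moves
    [x] downwards. *)
Lemma ordt_lt_irrefl a : ~ ordt_lt a a.
Proof.
case=> x [f _ fle].
have fi : {homo (fun y => val (f y)) : y z / wlt y z}.
  move=> y z; rewrite /wlt; apply: contra.
  by rewrite -[wle z y]fle; exact: id.
have := wle_increasing fi x; apply/negP; exact: valP (f x).
Qed.

Lemma ordt_le_trans b a c : ordt_le a b -> ordt_le b c -> ordt_le a c.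
Proof.
case=> ab [] bc.
- by left; exact: ordt_lt_trans bc.
- by left; exact: ordt_lt_eqr bc.
- by left; exact: ordt_lt_eql bc.
- by right; exact: ordt_eq_trans bc.
Qed.

Lemma ordt_lt_le_trans b a c : ordt_lt a b -> ordt_le b c -> ordt_lt a c.
Proof. by move=> ab []; [exact: ordt_lt_trans|exact: ordt_lt_eqr]. Qed.

Lemma oseg_inj a (x y : a) : ordt_eq (oseg x) (oseg y) -> x = y.
Proof.
have H u v : ordt_eq (oseg u) (oseg v) -> ~ @wlt a u v.
  move=> uv lt_uv; apply: (@ordt_lt_irrefl (oseg v)).
  apply: (ordt_lt_eql (ordt_eq_sym uv)); exists (exist _ u lt_uv).
  exact/ordt_eq_sym/ordt_eq_oseg2.
by move=> xy; case: (wlt_total x y) => //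
  [/(H _ _ xy)|/(H _ _ (ordt_eq_sym xy))].
Qed.

Lemma oseg_iso_lt a b (x x' : a) (y y' : b) : ordt_eq (oseg x) (oseg y) ->
  ordt_eq (oseg x') (oseg y') -> wlt x x' -> wlt y y'.
Proof.
move=> xy xy' ltxx'.
have : ordt_lt (oseg y) (oseg y').
  apply: (ordt_lt_eql (ordt_eq_sym xy)); apply: ordt_lt_eqr xy'.
  exact: oseg_ltP ltxx'.
by move=> /ordt_lt_oseg[z zy' /oseg_inj ->].
Qed.

(** Matching points by isomorphic segments yields only a relation; as it preserves the order,
    choices made in the two directions are mutually inverse. *)
Lemma ordt_eq_rel a b (r : a -> b -> Prop) :
  (forall x, exists y, r x y) -> (forall y, exists x, r x y) ->
  (forall x x' y y', r x y -> r x' y' -> wlt x x' <-> wlt y y') ->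
  ordt_eq a b.
Proof.
move=> /choice[f fP] /choice[g gP] rlt.
have E x x' y y' : r x y -> r x' y' -> wle x x' = wle y y'.
  by move=> rxy rxy'; apply: negb_inj; apply/idP/idP => /(rlt _ _ _ _ rxy' rxy).
exists f; last by move=> x y; apply/esym/E.
exists g => x; apply/wle_anti/andP; split.
- by rewrite (E _ _ _ _ (gP _) (fP _)) wlexx.
- by rewrite (E _ _ _ _ (fP _) (gP _)) wlexx.
- by rewrite -(E _ _ _ _ (fP (g x)) (gP x)) wlexx.
- by rewrite -(E _ _ _ _ (gP x) (fP (g x))) wlexx.
Qed.

Lemma oseg_iso_down a b (x : a) (y y' : b) :
  ordt_eq (oseg x) (oseg y) -> wlt y' y ->
  exists2 x', wlt x' x & ordt_eq (oseg x') (oseg y').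
Proof.
move=> /ordt_eq_sym xy y'y.
have /ordt_lt_oseg[x' x'x /ordt_eq_sym x'y'] : ordt_lt (oseg y') (oseg x).
  by apply: ordt_lt_eqr xy; exact: oseg_ltP.
by exists x'.
Qed.

(** The matched points of [b] are closed downwards, so they are either all of [b] or the points
    below the least unmatched one. *)
Lemma ordt_le_ex a b :
  (forall x : a, exists y : b, ordt_eq (oseg x) (oseg y)) -> ordt_le a b.
Proof.
move=> tot_a.
have rlt (x x' : a) (y y' : b) : ordt_eq (oseg x) (oseg y) ->
    ordt_eq (oseg x') (oseg y') -> wlt x x' <-> wlt y y'.
  move=> xy xy'; split; first exact: oseg_iso_lt.
  by apply: oseg_iso_lt; exact: ordt_eq_sym.
have [tot_b|/existsNP/wo_least[y0 ny0 ly0]] :=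
  pselect (forall y : b, exists x : a, ordt_eq (oseg x) (oseg y)).
  by right; exact: ordt_eq_rel tot_a tot_b rlt.
left; exists y0.
apply: (@ordt_eq_rel _ _
  (fun x (y : oseg y0) => ordt_eq (oseg x) (oseg (val y)))).
- move=> x; have [y xy] := tot_a x.
  suff yy0 : wlt y y0 by exists (exist _ y yy0).
  case: (wlt_total y y0) => // [yE|/(oseg_iso_down xy)[x' _ x'y0]].
    by case: ny0; exists x; rewrite -yE.
  by case: ny0; exists x'.
- move=> y; apply: contrapT => /ly0; apply/negP; exact: valP y.
- by move=> x x' y y'; exact: rlt.
Qed.

Lemma ordt_le_anti a b : ordt_le a b -> ordt_le b a -> ordt_eq a b.
Proof.
case=> [ab|//] ba; case: (@ordt_lt_irrefl a).
exact: ordt_lt_le_trans ba.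
Qed.

(* Matching the points with isomorphic segments exhausts [a] or [b]: the
   segments of the least unmatched points would be isomorphic. *)
Lemma ordt_le_total a b : ordt_le a b \/ ordt_le b a.
Proof.
have [/ordt_le_ex|/existsNP/wo_least[x0 nx0 lx0]] :=
  pselect (forall x : a, exists y : b, ordt_eq (oseg x) (oseg y)); first by left.
have [/ordt_le_ex|/existsNP/wo_least[y0 ny0 ly0]] :=
  pselect (forall y : b, exists x : a, ordt_eq (oseg y) (oseg x)); first by right.
have below (c d : ordType) (u : c) (v : d) :
    (forall u', (~ exists v', ordt_eq (@oseg c u') (@oseg d v')) -> wle u u') ->
    (~ exists u', ordt_eq (@oseg d v) (@oseg c u')) ->
    ordt_le (oseg u) (oseg v).
  move=> lu nv; apply: ordt_le_ex => x.
  have [y xy] : exists y, ordt_eq (@oseg c (val x)) (@oseg d y).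
    by apply: contrapT => /lu; apply/negP; exact: valP x.
  suff yv : wlt y v.
    exists (exist _ y yv); apply: (ordt_eq_trans (ordt_eq_oseg2 _)).
    exact/(ordt_eq_trans xy)/ordt_eq_sym/ordt_eq_oseg2.
  case: (wlt_total y v) => // [yE|/(oseg_iso_down xy)[x' _ /ordt_eq_sym x'v]].
    by case: nv; exists (val x); rewrite -yE; exact: ordt_eq_sym.
  by case: nv; exists x'.
case: (nx0); exists y0; apply: ordt_le_anti; exact: below.
Qed.

Lemma ordt_leNgt a b : ~ ordt_lt b a -> ordt_le a b.
Proof.
move=> nba; case: (ordt_le_total a b) => // -[//|/ordt_eq_sym].
by right.
Qed.

Lemma ordt_le_inj a b : ordt_le a b -> exists f : a -> b, injective f.
Proof.
case=> [[y [f bf _]]|[f bf _]]; last by exists f; exact: bij_inj.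
by exists (val \o f); apply: inj_comp (bij_inj bf); exact: val_inj.
Qed.

(* By Cantor's theorem, a well-order of the powerset of the disjoint union of
   the [F i] embeds into none of them. *)
Lemma ordt_sup (I : Type) (F : I -> ordType) :
  exists a, forall i, ordt_lt (F i) a.
Proof.
have [R Rwo] := well_ordering_principle (set {i & F i} : eqType).
exists (OrdType Rwo) => i; apply: contrapT => /ordt_leNgt/ordt_le_inj[f fI].
pose g (A : set {i & F i}) : {i & F i} := existT _ i (f A).
have gI : injective g.
  by move=> A B AB;
  exact: fI (@eq_from_Tagged {classic I} (fun i => osort (F i)) i _ _ AB).
pose D := [set x | exists2 A, g A = x & ~ A x].
have ND : ~ D (g D) by move=> D1; case: (D1) => A /gI ->.
by apply: (ND); exists D.
Qed.

(** Minimality over a class of types reduces to the elements of one member [a]: either a least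
    segment of [a] is in the class, or [a] itself is minimal. *)
Lemma ordt_min (P : ordType -> Prop) :
  (forall a b, ordt_eq a b -> P a -> P b) -> (exists a, P a) ->
  exists2 a, P a & forall b, P b -> ordt_le a b.
Proof.
move=> Peq [a Pa].
have [/wo_least[x Px lx]|na] := pselect (exists x : a, P (oseg x)).
  exists (oseg x) => // b Pb; apply: ordt_leNgt => /ordt_lt_oseg[y yx by_].
  by have := lx _ (Peq _ _ by_ Pb); apply/negP.
exists a => // b Pb; apply: ordt_leNgt => -[y by_].
by apply: na; exists y; exact: Peq Pb.
Qed.

End OrdinalComparison.

(** * The Borel rank *)

Section BorelRank.
Variable kappa : ordType.
Implicit Types (T U : topologicalType).

Lemma Sigma0_eq T a b (A : set T) :
  ordt_eq a b -> Sigma0 kappa a A -> Sigma0 kappa b A.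
Proof.
move=> + aA; case: aA b => {a A} [a A a1 oA|a c B a2 ca BP] b ab.
  by apply: Sigma0_open oA; apply: ordt_eq_trans a1; exact: ordt_eq_sym.
apply: (Sigma0_bigcup (b := c)) => //.
  by apply: ordt_le_trans a2 _; right.
by move=> i; have [c1 ia] := ca i; split=> //; exact: ordt_lt_eqr ab.
Qed.

Lemma Sigma0_preimage T U (f : T -> U) a (A : set U) : continuous f ->
  Sigma0 kappa a A -> Sigma0 kappa a (f @^-1` A).
Proof.
move=> /continuousP fc; elim=> {a A} [a A a1 oA|a b B a2 ba _ IH].
  by apply: Sigma0_open => //; exact: fc.
by rewrite preimage_bigcup; apply: (Sigma0_bigcup (b := b)).
Qed.

Lemma borel_level_eq T a b (A : set T) :
  ordt_eq a b -> borel_level kappa A a -> borel_level kappa A b.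
Proof.
move=> ab [a1 aA]; split; first by apply: ordt_le_trans a1 _; right.
by case: aA => aA; [left|right]; exact: Sigma0_eq aA.
Qed.

Lemma kappa_borel_level T (A : set T) : kappa -> kappa_borel kappa A ->
  exists a, borel_level kappa A a.
Proof.
move=> x0 /(_ [set B | exists a, borel_level kappa B a]); apply; split; last first.
  move=> B oB; exists (ofin 1); split; first by right; exact: ordt_eq_refl.
  by left; apply: Sigma0_open => //; exact: ordt_eq_refl.
split=> [B [a [a1 aB]]|F /choice[f fP]].
  exists a; split=> //; case: aB => aB; [right|left]; rewrite /Pi0 ?setCK //.
(* [g] lies strictly above every [f i], and [h] above [g]. If [F i] is [Sigma0 (f i)], its
   complement is [Sigma0 g] as a constant union, which is what a union at level [h] asks for. The
   extra indices keep both ordinals above 2. *)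
have [g gP] := ordt_sup (fun s : kappa + unit =>
  if s is inl i then f i else ofin 2).
have [h hP] := ordt_sup (fun s : kappa + bool =>
  match s with inl i => g | inr b => ofin b.+1 end).
exists h; split; first by left; exact: hP (inr false).
have h2 : ordt_le (ofin 2) h by left; exact: hP (inr true).
have gh : ordt_lt g h := hP (inl x0).
have g2 : ordt_le (ofin 2) g by left; exact: gP (inr tt).
have g1 : ordt_le (ofin 1) g.
  by have [f1 _] := fP x0; apply: ordt_le_trans f1 _; left; exact: gP (inl x0).
have /choice[b bP] i : exists b,
    [/\ ordt_le (ofin 1) b, ordt_lt b h & Sigma0 kappa b (~` F i)].
  have [f1 [fF|fF]] := fP i; last first.
    by exists (f i); split=> //; apply: ordt_lt_trans (gP (inl i)) gh.
  exists g; split=> //.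
  rewrite (_ : ~` F i = \bigcup_(j : kappa) ~` F i); last first.
    by apply/seteqP; split=> [x nFx|x [_ _]//]; exists x0.
  apply: (Sigma0_bigcup (b := fun=> f i)) => [||_]; last by rewrite setCK.
    exact: g2.
  by move=> _; split=> //; exact: gP (inl i).
left; apply: (Sigma0_bigcup (b := b)) => // i; by have [] := bP i.
Qed.

Lemma is_rank_ex T (A : set T) : kappa -> kappa_borel kappa A ->
  exists a, is_rank kappa A a.
Proof.
move=> x0 KA; have [cA|ncA] := pselect (clopen A).
  by exists (ofin 0); split=> // _; exact: ordt_eq_refl.
have [a aA amin] := ordt_min (fun a b => @borel_level_eq T a b A)
  (kappa_borel_level x0 KA).
by exists a; split.
Qed.

(** Rank 0 marks the clopen sets, whereas levels begin at 1 and clopen sets already occur there: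
    hence the maximum with 1. *)
Lemma rk_B_level T (A : set T) a : kappa -> rk_B kappa A = Rank a ->
  borel_level kappa A (ordt_max a (ofin 1)).
Proof.
move=> x0; rewrite /rk_B; case: asboolP => // /(is_rank_ex x0) exA [].
case: pselect => // exA'; case: cid => d /= [d0 dlvl] <-{a}; rewrite /ordt_max.
have d_level : ~ clopen A -> borel_level kappa A d by move=> /dlvl[].
case: asboolP => [d_le1|nd_le1].
  have [[oA _]|ncA] := pselect (clopen A).
    split; first by right; exact: ordt_eq_refl.
    by left; apply: Sigma0_open => //; exact: ordt_eq_refl.
  have [d1 dA] := d_level ncA; apply: (borel_level_eq _ (d_level ncA)).
  exact: ordt_le_anti.
apply: d_level => /d0 d0E; apply: nd_le1; apply: ordt_leNgt.
by move=> /ordt_lt_eqr/(_ d0E)[[]].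
Qed.

End BorelRank.

(** * Regular cardinals *)

(** An injection given by a relation, which may be multivalued, spares choosing values and handling
    subtypes. *)
Lemma card_le_rel T U (A : set T) (B : set U) :
  A #<= B <-> exists r : T -> U -> Prop,
    (forall x, A x -> exists2 y, B y & r x y) /\
    (forall x x' y, A x -> A x' -> r x y -> r x' y -> x = x').
Proof.
split=> [/card_leP[f]|[r [rAB rinj]]].
  exists (fun x y => exists x' : A, val x' = x /\ val (f x') = y); split.
    move=> x Ax; exists (val (f (exist _ x (mem_set Ax)))).
      exact: set_valP.
    by exists (exist _ x (mem_set Ax)).
  move=> _ _ y _ _ [x [<- <-]] [x' [<- /val_inj fxx']].
  by congr set_val; apply: (@inj _ _ _ f); rewrite ?inE.
have /choice[f fP] (x : A) : exists y : B, r (val x) (val y).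
  by have [y By rxy] := rAB _ (set_valP x); exists (exist _ y (mem_set By)).
apply/card_leP/injfunPex; exists f => // x x' _ _ fxx'.
apply/val_inj/(rinj _ _ (val (f x))) => //; try exact: set_valP.
by rewrite fxx'.
Qed.

Lemma card_lt_le T U V (A : set T) (B : set U) (C : set V) :
  A #<= B -> card_lt B C -> card_lt A C.
Proof.
move=> AB [BC nCB]; split; first exact: card_le_trans BC.
by move=> CA; apply: nCB; exact: card_le_trans AB.
Qed.

Section RegularCardinal.
Variable kappa : ordType.
Hypothesis kappa_card : infinite_cardinal kappa.
Hypothesis kappa_lt : [set: short_seq kappa] #= [set: kappa].

Notation small A := (card_lt A [set: kappa]).

(** The form in which the hypothesis on short sequences is applied: [c] codes a total function
    [e c], meaningful only below the length of the coded sequence. *)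
Lemma short_seq_enum : exists e : kappa -> kappa -> kappa,
  forall x h, exists c, forall i, wlt i x -> e c i = h i.
Proof.
have /card_le_rel[r [r_ex r_inj]] : [set: short_seq kappa] #<= [set: kappa].
  by move: kappa_lt; rewrite card_eq_le => /andP[].
have /choice[e eP] c : exists s : kappa -> kappa, forall q, r q c ->
    forall i (ix : wlt i (projT1 q)), s i = projT2 q (exist _ i ix).
  have [[q rq]|nq] := pselect (exists q, r q c); last first.
    by exists id => q rq; case: nq; exists q.
  exists (fun i => match pselect (wlt i (projT1 q)) with
    | left ix => projT2 q (exist _ i ix) | right _ => i end).
  move=> q' rq' i; rewrite -(r_inj q q' c) // => ix.
  by case: pselect => // ix'; congr (projT2 q _); exact: val_inj.
exists e => x h.
have [//|c _ rc] := r_ex (existT _ x (fun i => h (val i))).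
by exists c => i ix; rewrite (eP c _ rc i ix).
Qed.

(** These serve as a two-element index set for binary unions and for pairs. Of three distinct
    points, the largest is the bound. *)
Lemma two_below : exists u v x : kappa, [/\ u <> v, wlt u x & wlt v x].
Proof.
apply: contrapT => nuv; have [kappa_inf _] := kappa_card.
have [u _] := infinite_setN0 kappa_inf.
have [v [_ /= uv]] := infinite_setN0 (infinite_setD kappa_inf (finite_set1 u)).
have [w [_ /not_orP[uw vw]]] :=
  infinite_setN0 (infinite_setD kappa_inf (finite_set2 u v)).
have lt x y : x <> y -> ~ wlt y x -> wlt x y by case: (wlt_total x y).
apply: nuv; case: (pselect (wlt u v)) => [luv|/lt luv].
  case: (pselect (wlt v w)) => [lvw|/lt lvw].
    by exists u, v, w; split=> [/esym||] //; exact: wlt_trans lvw.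
  exists u, w, v; split=> [/esym||] //; exact: lvw.
have {}luv : wlt v u by exact: luv.
case: (pselect (wlt u w)) => [luw|/lt luw].
  by exists u, v, w; split=> [/esym||] //; exact: wlt_trans luw.
by exists v, w, u; split=> [/esym||] //; exact: luw.
Qed.

(** A pair is coded by a short sequence with its components at the places [u] and [v]. *)
Lemma pairing : exists f g : kappa -> kappa,
  forall x y, exists c, f c = x /\ g c = y.
Proof.
have [e eP] := short_seq_enum; have [u [v [z [uv uz vz]]]] := two_below.
exists (e ^~ u), (e ^~ v) => x y.
have [c cP] := eP z (fun i => if `[< i = u >] then x else y).
exists c; rewrite !cP //; split; first by case: asboolP.
by case: asboolP => // /esym.
Qed.

(* Koenig's diagonal argument: if the [F i] covered [kappa], some sequence of
   length [x] would differ at each place [i] from those enumerated in [F i]. *)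
Lemma small_bigcup T (x : kappa) (F : kappa -> set T) :
  (forall i, wlt i x -> small (F i)) ->
  small (\bigcup_(i in [set i | wlt i x]) F i).
Proof.
move=> Fs; split.
  (* The union has size at most kappa: code an element by its index [i] paired with its code inside
     [F i]. *)
  have [f [g fgP]] := pairing.
  have /choice[R RP] i : exists r : T -> kappa -> Prop, wlt i x ->
      (forall t, F i t -> exists y, r t y) /\
      (forall t t' y, F i t -> F i t' -> r t y -> r t' y -> t = t').
    have [ix|nix] := pselect (wlt i x); last by exists (fun _ _ => True).
    have [/card_le_rel[r [r_ex r_inj]] _] := Fs i ix.
    by exists r; split=> // t /r_ex[y]; exists y.
  apply/card_le_rel.
  exists (fun t c => [/\ wlt (f c) x, F (f c) t & R (f c) t (g c)]); split.
    move=> t [i ix Fit]; have [+ _] := RP i ix => /(_ t Fit)[y Rity].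
    by have [c [fc gc]] := fgP i y; exists c => //; rewrite fc gc.
  move=> t t' c _ _ [cx Ft Rt] [_ Ft' Rt'].
  by have [_] := RP _ cx; apply; [exact: Ft|exact: Ft'|exact: Rt|].
move=> /card_le_rel[r [r_ex r_inj]].
have [e eP] := short_seq_enum.
(* The values at [i] of the sequences matched with elements of the small set [F i] miss some [y]. *)
have /choice[h hP] i : exists y, wlt i x ->
    forall c t, F i t -> r c t -> e c i <> y.
  have [ix|nix] := pselect (wlt i x); last by exists x.
  apply: contrapT => ny; have [_] := Fs i ix; apply; apply/card_le_rel.
  exists (fun y t => exists2 c, r c t & e c i = y); split; last first.
    by move=> y y' t _ _ [c rc <-] [c' rc' <-]; rewrite (r_inj c c' t).
  move=> y _; apply: contrapT => nt; apply: ny; exists y => _ c t Fit rct ecy.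
  by apply: nt; exists t => //; exists c.
have [c ce] := eP x h; have [//|t [i ix Fit] rct] := r_ex c.
exact: (hP i ix c t Fit rct (ce i ix)).
Qed.

Lemma small_setU T (A B : set T) : small A -> small B -> small (A `|` B).
Proof.
move=> As Bs; have [u [v [x [uv ux vx]]]] := two_below.
have := @small_bigcup T x (fun i => if `[< i = u >] then A else B).
move=> /(_ _)/(card_lt_le _); apply; last by move=> i _; case: asboolP.
apply: subset_card_le => t [At|Bt].
  by exists u => //; case: asboolP.
by exists v => //; case: asboolP => // /esym.
Qed.

Lemma small_sub T (A B : set T) : A `<=` B -> small B -> small A.
Proof. by move=> /subset_card_le; exact: card_lt_le. Qed.

Lemma small_image T U (f : T -> U) A : small A -> small (f @` A).
Proof. exact/card_lt_le/card_image_le. Qed.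

Lemma small1 T (x : T) : small [set x].
Proof.
have [kappa_inf _] := kappa_card; split.
  have [y _] := infinite_setN0 kappa_inf.
  apply/card_le_rel; exists (fun _ _ => True).
  by split=> [|? ? ? -> ->]//; exists y.
by move=> /card_le_finite/(_ (finite_set1 x)).
Qed.

Lemma small0 T : small (@set0 T).
Proof.
split; first exact: card_ge0.
rewrite card_le0 => /eqP k0; have [kappa_inf _] := kappa_card.
by have [x] := infinite_setN0 kappa_inf; rewrite k0.
Qed.

Lemma small_bounded (D : set kappa) : bounded_set D -> small D.
Proof.
move=> [x Dx]; have [_ /(_ x)] := kappa_card; apply/card_lt_le/card_le_rel.
exists (fun y s => y = val s); split=> [y /Dx yx|? ? s _ _ -> ->//].
by exists (exist _ y yx).
Qed.

(** * Generic bijections of a regular cardinal *)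

(* Conditions are graphs of small partial injections of [kappa]; the generic
   objects they approximate are the bijections of [kappa]. *)
Definition condition (p : set (kappa * kappa)) :=
  [/\ functional p, forall x x' y, p (x, y) -> p (x', y) -> x = x' & small p].

Definition graph (h : kappa -> kappa) : set (kappa * kappa) :=
  [set xy | h xy.1 = xy.2].

Definition meets (D : set_system (kappa * kappa)) (h : kappa -> kappa) :=
  exists p, [/\ condition p, D p & p `<=` graph h].

Definition dense (D : set_system (kappa * kappa)) :=
  forall p, condition p -> exists q, [/\ condition q, p `<=` q & D q].

(** Category is taken in the space of bijections whose basic open sets are given by conditions;
    functions that are not bijective are ignored. *)
Definition comeager (G : set (kappa -> kappa)) :=
  exists D : kappa -> set_system (kappa * kappa), (forall i, dense (D i)) /\
    forall h, bijective h -> (forall i, meets (D i) h) -> G h.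

Lemma comeagerS (G G' : set (kappa -> kappa)) :
  (forall h, bijective h -> G h -> G' h) -> comeager G -> comeager G'.
Proof.
by move=> GG' [D [Dd DG]]; exists D; split=> // h bh /(DG _ bh); exact: GG'.
Qed.

Lemma comeager_dense D : dense D -> comeager (meets D).
Proof.
have [u _] := two_below.
by move=> Dd; exists (fun=> D); split=> // h _ /(_ u).
Qed.

(** Pairing merges kappa many families of dense sets into a single one. *)
Lemma comeager_bigcap (G : kappa -> set (kappa -> kappa)) :
  (forall i, comeager (G i)) -> comeager (\bigcap_i G i).
Proof.
move=> /choice[D DP]; have [f [g fgP]] := pairing.
exists (fun c => D (f c) (g c)); split=> [c|h bh hD i _].
  by have [] := DP (f c).
have [_] := DP i; apply=> // j.
by have [c [<- <-]] := fgP i j.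
Qed.

Lemma comeagerI (G G' : set (kappa -> kappa)) :
  comeager G -> comeager G' -> comeager (G `&` G').
Proof.
move=> cG cG'; have [u [v [_ [uv _ _]]]] := two_below.
apply: (comeagerS _ (@comeager_bigcap
  (fun i => if `[< i = u >] then G else G') _)) => [h _ hGG'|i].
  split; first by have := hGG' u I; case: asboolP.
  by have := hGG' v I; case: asboolP => // /esym.
by case: asboolP.
Qed.

Lemma condition_graph p h : bijective h -> p `<=` graph h -> small p ->
  condition p.
Proof.
move=> /bij_inj hI ph sp; have hE x y : p (x, y) -> h x = y by move=> /ph.
split=> // [x y y' /hE <- /hE <-//|x x' y /hE <- /hE /hI].
exact: esym.
Qed.

Lemma condition_inv p : condition p -> condition [set xy | p (xy.2, xy.1)].
Proof.
move=> [fp ip sp]; split=> [x y y'|x x' y|]; [exact: ip|exact: fp|].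
apply: small_sub (small_image (fun xy => (xy.2, xy.1)) sp).
by move=> [x y] /= pyx; exists (y, x).
Qed.

(** The range of [p] is small, so a value outside it is available for a new point. *)
Lemma condition_dom p x : condition p ->
  exists q, [/\ condition q, p `<=` q & exists y, q (x, y)].
Proof.
move=> cp; have [[y pxy]|npx] := pselect (exists y, p (x, y)).
  by exists p; split=> //; exists y.
have [fp ip sp] := cp.
have [y npy] : exists y, ~ (snd @` p) y.
  apply/existsNP => all_p; have [_] := small_image snd sp; apply.
  by apply: subset_card_le => y _; exact: all_p.
have nyp z : ~ p (z, y) by move=> pzy; apply: npy; exists (z, y).
exists (p `|` [set (x, y)]); split=> [|z|]; last by exists y; right.
  split; last exact/(small_setU sp)/small1.
    move=> z u u' [pzu|[-> ->]] [pzu'|[]] //.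
    - exact: fp pzu pzu'.
    - by move=> zx _; case: npx; exists u; rewrite -zx.
    - by case: npx; exists u'.
  move=> z z' u [pzu|[-> ->]] [pzu'|[]] //.
  - exact: ip pzu pzu'.
  - by move=> _ uy; case: (nyp z); rewrite -uy.
  - by case: (nyp z').
by left.
Qed.

Lemma condition_ran p y : condition p ->
  exists q, [/\ condition q, p `<=` q & exists x, q (x, y)].
Proof.
move=> /condition_inv/(condition_dom y)[q [/condition_inv cq pq [x qyx]]].
exists [set xy | q (xy.2, xy.1)]; split=> [//|[u v] puv|]; last by exists x.
exact: (pq (v, u)).
Qed.

(** This builds chains of conditions, where a stage depends on the union of the earlier ones. *)
Lemma wlt_rec T (F : kappa -> set T -> set T) : exists P : kappa -> set T,
  forall x, P x = F x (\bigcup_(y in [set y | wlt y x]) P y).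
Proof.
pose G x (P : forall y, wlt y x -> set T) : set T :=
  F x [set t | exists y (yx : wlt y x), P y yx t].
exists (Fix (@wlt_wf kappa) (fun=> set T) G) => x; rewrite Fix_eq.
  by congr (F x _); apply/seteqP; split=> [t [y [yx Pt]]|t [y yx Pt]]; exists y.
move=> {}x f g fg; congr (F x _); apply/seteqP.
by split=> t [y [yx]]; [rewrite fg|rewrite -fg]; exists y, yx.
Qed.

(** Stage [x] extends the union of [p] and the earlier stages, meets [D x], and puts [x] into the
    domain and the range. The union before each stage is small by regularity, hence a condition; the
    union of all stages is the graph of the required bijection. *)
Theorem baire G p : condition p -> comeager G ->
  exists h, [/\ bijective h, p `<=` graph h & G h].
Proof.
move=> cp [D [Dd DG]].
(* Off conditions, [ext] takes the junk value [setT]. *)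
have /choice[ext extP] (xq : kappa * set (kappa * kappa)) : exists r,
    condition xq.2 -> [/\ condition r, xq.2 `<=` r,
      exists d, [/\ condition d, D xq.1 d & d `<=` r],
      exists y, r (xq.1, y) & exists y, r (y, xq.1)].
  have [cq|] := pselect (condition xq.2); last by exists setT.
  have [d [cd qd Dxd]] := Dd xq.1 _ cq.
  have [r [cr dr [y rxy]]] := condition_dom xq.1 cd.
  have [s [cs rs sx]] := condition_ran xq.1 cr.
  exists s => _; split=> //; last by exists y; exact: rs.
    exact/(subset_trans qd)/(subset_trans dr).
  by exists d; split=> //; exact: subset_trans rs.
have [P PE] := wlt_rec (fun x q => ext (x, p `|` q)).
set Q := fun x => p `|` \bigcup_(y in [set y | wlt y x]) P y.
have {}PE x : P x = ext (x, Q x) := PE x.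
(* Being a partial injection concerns two pairs at a time, so it passes to unions of chains. *)
have glue (A : set (kappa * kappa)) :
    (forall z z', A z -> A z' -> exists2 c, condition c & c z /\ c z') ->
    functional A /\ forall x x' y, A (x, y) -> A (x', y) -> x = x'.
  move=> Ac; split=> [x y y' Axy Axy'|x x' y Axy Ax'y].
    by have [c [fc _ _] []] := Ac _ _ Axy Axy'; exact: fc.
  by have [c [_ ic _] []] := Ac _ _ Axy Ax'y; exact: ic.
have QP x y : wlt x y -> P x `<=` Q y by move=> xy z Pz; right; exists x.
have cQ x : condition (Q x).
  elim/wlt_ind: x => x IH.
  have cP y : wlt y x -> condition (P y) /\ Q y `<=` P y.
    by move=> yx; rewrite PE; have [] := extP (y, Q y) (IH _ yx).
  have pP y : wlt y x -> p `<=` P y.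
    by move=> /cP[_ QPy] z pz; apply: QPy; left.
  have [fQ iQ] : functional (Q x) /\
      forall y y' z, Q x (y, z) -> Q x (y', z) -> y = y'.
    apply: glue => z z' [pz|[y /= yx Pyz]] [pz'|[y' /= y'x Pyz']].
    - by exists p.
    - by exists (P y'); [have [] := cP _ y'x|split=> //; exact: pP pz].
    - by exists (P y); [have [] := cP _ yx|split=> //; exact: pP pz'].
    - case: (wlt_total y y') => [yy'|yE|y'y].
      + exists (P y'); first by have [] := cP _ y'x.
        by split=> //; have [_] := cP _ y'x; apply; exact: QP yy' _ Pyz.
      + by exists (P y); [have [] := cP _ yx|rewrite {2}yE].
      + exists (P y); first by have [] := cP _ yx.
        by split=> //; have [_] := cP _ yx; apply; exact: QP y'y _ Pyz'.
  split=> //; apply: small_setU; first by case: cp.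
  by apply: small_bigcup => y /cP[[]].
have {}extP x := extP (x, Q x) (cQ x).
have cP x : condition (P x) by rewrite PE; have [] := extP x.
have QPx x : Q x `<=` P x by rewrite PE; have [] := extP x.
have [fG iG] : functional (\bigcup_x P x) /\
    forall y y' z, (\bigcup_x P x) (y, z) -> (\bigcup_x P x) (y', z) -> y = y'.
  apply: glue => z z' [y _ Pz] [y' _ Pz'].
  case: (wlt_total y y') => [yy'|yE|y'y].
  - by exists (P y') => //; split=> //; exact/QPx/(QP _ _ yy').
  - by exists (P y) => //; rewrite {2}yE.
  - by exists (P y) => //; split=> //; exact/QPx/(QP _ _ y'y).
have /choice[h hP] x : exists y, P x (x, y).
  by have [_ _ _ [y Pxy] _] := extP x; exists y; rewrite PE.
have /choice[k kP] x : exists y, P x (y, x).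
  by have [_ _ _ _ [y Pyx]] := extP x; exists y; rewrite PE.
have PG x : P x `<=` graph h.
  move=> [y z] Pyz; apply: (fG y (h y) z); [exists y|exists x] => //.
have bh : bijective h.
  exists k => x; last exact: PG (kP x).
  by apply: (iG _ _ (h x)); [exists (h x)|exists x].
exists h; split=> //.
  have [u _] := two_below.
  by apply: subset_trans (PG u); apply: subset_trans (QPx u) => z; left.
apply: DG => // i; have [_ _ [d [cd Did dP]] _ _] := extP i.
by exists d; split=> //; apply: subset_trans (PG i); rewrite PE.
Qed.

Definition forces (p : set (kappa * kappa)) (G : set (kappa -> kappa)) :=
  comeager [set h | p `<=` graph h -> G h].

Lemma forces_ex p G : condition p -> forces p G ->
  exists h, [/\ bijective h, p `<=` graph h & G h].
Proof. by move=> cp /(baire cp)[h [bh ph /(_ ph)]]; exists h. Qed.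

Lemma forces_sub p q G : p `<=` q -> forces p G -> forces q G.
Proof. by move=> pq; apply: comeagerS => h _ pG /(subset_trans pq). Qed.

(** [meets U] is the open set generated by [U], so [G] is open up to a meager set. *)
Definition baire_property (G : set (kappa -> kappa)) :=
  exists U, comeager [set h | G h <-> meets U h].

Lemma condition_setU h p q : bijective h -> condition p -> condition q ->
  p `<=` graph h -> q `<=` graph h -> condition (p `|` q).
Proof.
move=> bh [_ _ sp] [_ _ sq] ph qh; apply: (condition_graph bh).
  by rewrite subUset.
exact: small_setU.
Qed.

(** The open set for the complement is generated by the conditions [V] incompatible with every
    member of [U]; those deciding between [U] and [V] form a dense set [E]. *)
Lemma baire_property_setC G : baire_property G -> baire_property (~` G).
Proof.
move=> [U UG].
pose V := [set p | forall u, condition u -> U u ->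
  forall q, condition q -> p `<=` q -> ~ u `<=` q].
pose E := [set p | V p \/ exists u, [/\ condition u, U u & u `<=` p]].
have Ed : dense E.
  move=> p cp; have [Vp|] := pselect (V p); first by exists p; split=> //; left.
  move=> /existsNP[u /not_implyP[cu /not_implyP[Uu /existsNP[q]]]].
  move=> /not_implyP[cq /not_implyP[pq /contrapT uq]].
  by exists q; split=> //; right; exists u.
exists V; apply: (comeagerS _ (comeagerI UG (comeager_dense Ed))).
move=> h bh [GU [p [cp Ep ph]]]; split=> [nGh|[q [cq Vq qh]] /GU[u [cu Uu uh]]].
  exists p; split=> //; case: Ep => // -[u [cu Uu up]].
  by case: nGh; apply/GU; exists u; split=> //; exact: subset_trans ph.
have cqu := condition_setU bh cq cu qh uh.
by apply: (Vq u cu Uu _ cqu) => z; [left|right].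
Qed.

Lemma baire_property_bigcup (G : kappa -> set (kappa -> kappa)) :
  (forall i, baire_property (G i)) -> baire_property (\bigcup_i G i).
Proof.
move=> /choice[U UG]; exists (\bigcup_i U i).
apply: comeagerS (comeager_bigcap UG) => h _ GU.
split=> [[i _ /(GU i I)[p [cp Up ph]]]|[p [cp [i _ Up] ph]]].
  by exists p; split=> //; exists i.
by exists i => //; apply/(GU i I); exists p.
Qed.

Lemma baire_property_open (G : set (kappa -> kappa)) :
  (forall h, bijective h -> G h -> exists p, [/\ condition p, p `<=` graph h &
    forall k, bijective k -> p `<=` graph k -> G k]) ->
  baire_property G.
Proof.
move=> Gopen; exists [set p | forall k, bijective k -> p `<=` graph k -> G k].
exists (fun=> setT); split=> [_ p cp|h bh _]; first by exists p; split.
split=> [/(Gopen _ bh)[p [cp ph pG]]|[p [_ pG]]]; first by exists p.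
exact: pG.
Qed.

(** If [p] is compatible with some member of [U], a common extension forces [G]; otherwise no
    bijection extending [p] meets [U]. *)
Lemma forces_or p G : baire_property G -> condition p ->
  forces p (~` G) \/ exists q, [/\ condition q, p `<=` q & forces q G].
Proof.
move=> [U UG] cp.
have [[u [q [cu Uu [cq pq uq]]]]|nU] := pselect (exists u q,
    [/\ condition u, U u & [/\ condition q, p `<=` q & u `<=` q]]).
  right; exists q; split=> //; apply: comeagerS UG => h _ GU qh.
  by apply/GU; exists u; split=> //; exact: subset_trans qh.
left; apply: comeagerS UG => h bh GU ph /GU[u [cu Uu uh]].
apply: nU; exists u, (p `|` u); split=> //.
by split=> [|z|z]; [exact: condition_setU uh|left|right].
Qed.

(** Otherwise [p] forces all the complements at once, and [baire] yields a bijection in the union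
    but in none of the [G i]. *)
Lemma forces_bigcup p (G : kappa -> set (kappa -> kappa)) :
  (forall i, baire_property (G i)) -> condition p -> forces p (\bigcup_i G i) ->
  exists i q, [/\ condition q, p `<=` q & forces q (G i)].
Proof.
move=> GP cp pG; apply: contrapT => nG.
have pnG i : forces p (~` G i).
  have [//|[q [cq pq qG]]] := forces_or (GP i) cp.
  by case: nG; exists i, q.
have [h [_ ph [h1 h2]]] := baire cp (comeagerI pG (comeager_bigcap pnG)).
by have [i _ Gih] := h1 ph; exact: h2 i I ph Gih.
Qed.

End RegularCardinal.

(** * Transfer of forcing along back-and-forth systems *)

Section Topology.
Variables (kappa : ordType) (L : language).
Hypothesis kappa_card : infinite_cardinal kappa.
Hypothesis kappa_lt : [set: short_seq kappa] #= [set: kappa].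

Notation small A := (card_lt A [set: kappa]).

Definition agree_on (D : set kappa) (M N : Mod kappa L) :=
  forall (R : L) (t : 'I_(arity R) -> kappa),
    (forall j, D (t j)) -> M R t <-> N R t.

(** The trace of openness kept for forcing: a small part of the domain, taken with the whole
    language, witnesses membership. *)
Definition local_set (O : set (Mod kappa L)) := forall M, O M ->
  exists D, small D /\ forall N, agree_on D M N -> O N.

Lemma local_setI O O' : local_set O -> local_set O' -> local_set (O `&` O').
Proof.
move=> lO lO' M [/lO[D [sD DO]] /lO'[D' [sD' DO']]].
exists (D `|` D'); split; first exact: small_setU.
move=> N MN; split; [apply: DO|apply: DO'] => R t tD; apply: MN => j.
  by left.
by right.
Qed.

Lemma local_subbase (O : set (Mod kappa L)) : Mod_subbase O -> local_set O.
Proof.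
move=> [L' [D [Q [_ bD ->]]]] M QM; exists D; split; first exact: small_bounded.
move=> N MN R t; apply: iff_trans (QM R t) _; apply: MN => j.
exact: set_valP.
Qed.

Lemma local_set_bigcap (s : seq (set (Mod kappa L))) :
  (forall O, O \in s -> Mod_subbase O) -> local_set (\bigcap_(O in [set` s]) O).
Proof.
elim: s => [_ M _|O s IH sb].
  by exists set0; split=> [|N _ O]; first exact: small0.
have -> : [set` O :: s] = O |` [set` s].
  by apply/seteqP; split=> O' /=; rewrite inE => /predU1P.
rewrite bigcap_setU1; apply: local_setI.
  by apply/local_subbase/sb; rewrite inE eqxx.
by apply: IH => O' sO'; apply: sb; rewrite inE sO' orbT.
Qed.

Lemma open_local (O : set (Mod kappa L)) : open O -> local_set O.
Proof.
move=> [F Fb <-] M [U FU UM].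
have [s [sb sU]] : exists s : seq (set (Mod kappa L)),
    (forall V, V \in s -> Mod_subbase V) /\ \bigcap_(V in [set` s]) V = U.
  have [s sb sU] := Fb _ FU; exists (finmap.enum_fset s); split=> // V Vs.
  by have := sb V Vs; rewrite inE.
have [|D [sD DU]] := local_set_bigcap sb (M := M); first by rewrite sU.
by exists D; split=> // N /DU; rewrite sU; exists U.
Qed.

Definition pull (h : kappa -> kappa) (N : Mod kappa L) : Mod kappa L :=
  fun R t => N R (h \o t).

Lemma isomorphic_pull h N : bijective h -> isomorphic (pull h N) N.
Proof. by move=> bh; exists h. Qed.

Lemma isomorphic_sym (M N : Mod kappa L) : isomorphic M N -> isomorphic N M.
Proof.
case=> f [g fK gK] fMN; exists g => [|R t]; first by exists f.
rewrite fMN (_ : f \o (g \o t) = t)//.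
by apply/funext => j; exact: gK.
Qed.

Lemma isomorphic_trans (M N P : Mod kappa L) :
  isomorphic M N -> isomorphic N P -> isomorphic M P.
Proof.
case=> f bf fMN [g bg gNP]; exists (g \o f); first exact: bij_comp.
by move=> R t; rewrite fMN gNP.
Qed.

Variable K : set (Mod kappa L).
Hypothesis K_inv : iso_invariant K.

(** The default [N] is never taken for a bijection [h], by invariance of [K]. *)
Definition act (h : kappa -> kappa) (N : set_type K) : set_type K :=
  insubd N (pull h (set_val N)).

Lemma act_val h N : bijective h -> set_val (act h N) = pull h (set_val N).
Proof.
move=> bh; rewrite /act [set_val _]val_insubd ifT// inE.
by apply: K_inv (set_valP N); exact/isomorphic_sym/isomorphic_pull.
Qed.

(** This is the preimage of [A] under the orbit map of [N]; forcing it is a Vaught transform. *)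
Definition orbit (A : set (set_type K)) (N : set_type K) :
  set (kappa -> kappa) := [set h | A (act h N)].

Lemma open_set_type_local (A : set (set_type K)) z : open A -> A z ->
  exists D, small D /\ forall z', agree_on D (set_val z) (set_val z') -> A z'.
Proof.
move=> [O oO <-] Oz; have [D [sD DO]] := open_local oO Oz.
by exists D; split=> // z' /DO.
Qed.

(** For open [A], a small set [D] witnesses membership of [act h N], and the structure on [D] is
    determined by the restriction of [h] to [D], which is a condition. Complements and unions do the
    rest. *)
Lemma baire_orbit a (A : set (set_type K)) N :
  Sigma0 kappa a A -> baire_property (orbit A N).
Proof.
elim=> {a A} [a A _ oA|a b B _ _ _ IH].
  apply: baire_property_open => // h bh Ah.
  have [D [sD DA]] := open_set_type_local oA Ah.
  exists ((fun d => (d, h d)) @` D).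
  have Dh : (fun d => (d, h d)) @` D `<=` graph h by move=> _ [d _ <-].
  split=> // [|k bk Dk].
    by apply: (condition_graph bh) => //; exact: small_image.
  apply: DA => R t tD; rewrite !act_val// /pull (_ : h \o t = k \o t)//.
  by apply/funext => j; apply/esym/(Dk (t j, h (t j))); exists (t j).
apply: (@baire_property_bigcup _ _ _ (fun i => orbit (B i) N)) => // i.
rewrite -[orbit _ _]setCK; exact: baire_property_setC (IH i).
Qed.

Definition ginv (f : set (kappa * kappa)) := [set xy | f (xy.2, xy.1)].

Lemma ginvK f : ginv (ginv f) = f.
Proof. by apply/seteqP; split=> -[]. Qed.

Lemma partial_isomorphism_sym (M N : Mod kappa L) f :
  partial_isomorphism M N f -> partial_isomorphism N M (ginv f).
Proof.
move=> [ff fi fMN]; split=> [x y y'|x x' y|R t u tu]; [exact: fi|exact: ff|].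
by apply: iff_sym; exact: fMN.
Qed.

Lemma partial_isomorphismS (M N : Mod kappa L) f g : f `<=` g ->
  partial_isomorphism M N g -> partial_isomorphism M N f.
Proof.
move=> fg [gf gi gMN]; split=> [x y y' /fg + /fg|x x' y /fg + /fg|R t u tu].
- exact: gf.
- exact: gi.
- by apply: gMN => j; exact/fg/tu.
Qed.

(** [S a f] stands for a position [f] from which II can survive while I descends through the
    ordinals below [a]. *)
Definition back_and_forth (M N : Mod kappa L)
    (S : ordType -> set (kappa * kappa) -> Prop) :=
  forall a f, S a f -> partial_isomorphism M N f /\
    forall b, ordt_lt b a -> forall C, small C ->
      exists g, [/\ f `<=` g, C `<=` gdom g `&` gran g & S b g].

Lemma back_and_forth_sym M N S : back_and_forth M N S ->
  back_and_forth N M (fun a f => S a (ginv f)).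
Proof.
move=> bfS a f /bfS[piso ext]; split=> [|b ba C sC].
  by rewrite -(ginvK f); exact: partial_isomorphism_sym.
have [g [fg Cg Sg]] := ext b ba C sC; exists (ginv g); split.
- by move=> [x y] fxy; exact: (fg (y, x)).
- move=> x /Cg[[[x' y] gxy /= x'x] [[z x''] gzx /= x''x]].
  rewrite {}x'x in gxy; rewrite {}x''x in gzx.
  by split; [exists (x, z)|exists (y, x)].
- by rewrite ginvK.
Qed.

(** The composite of [p] followed by [f]: a condition at [M] is carried by [f] to a condition at
    [N]. *)
Definition gcomp (f p : set (kappa * kappa)) :=
  [set xz | exists2 y, p (xz.1, y) & f (y, xz.2)].

Lemma condition_gcomp (M N : Mod kappa L) f p : partial_isomorphism M N f ->
  condition p -> condition (gcomp f p).
Proof.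
move=> [ff fi _] [fp ip sp]; split.
- by move=> x y y' [z /= /fp pxz fzy] [z' /= /pxz <-]; exact: ff.
- move=> x x' y [z /= pxz fzy] [z' /= + fz'y].
  by rewrite -(fi _ _ _ fzy fz'y); exact: ip.
apply: card_lt_le sp; apply/card_le_rel.
exists (fun xz xy => [/\ xz.1 = xy.1, p xy & f (xy.2, xz.2)]); split.
  by move=> [x z] [y /= pxy fyz]; exists (x, y).
move=> [x z] [x' z'] [u y] _ _ [/= -> _ fyz] [/= -> _ fyz'].
by rewrite (ff _ _ _ fyz fyz').
Qed.

(** Going forth along [f] and back along a larger [g] loses nothing of [p], whose range [f]
    covers. *)
Lemma sub_gcomp_ginv f g p q : gran p `<=` gdom f -> f `<=` g ->
  gcomp f p `<=` q -> p `<=` gcomp (ginv g) q.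
Proof.
move=> pf fg pq [x y] pxy; have [|[y' z] fyz /= yE] := pf y.
  by exists (x, y).
rewrite {}yE in fyz; exists z; last exact: fg.
by apply: pq; exists y.
Qed.

(* If some [q] extending [f \o p] forced [B] at [N], player II's answers would
   pull [q] back to an extension of [p] forcing [B] at [M]. *)
Lemma forces_transfer a (B : set (set_type K)) : Sigma0 kappa a B ->
  forall (M N : set_type K) S f p,
  back_and_forth (set_val M) (set_val N) S -> S a f -> condition p ->
  gran p `<=` gdom f ->
  forces p (orbit (~` B) M) -> forces (gcomp f p) (orbit (~` B) N).
Proof.
elim=> {a B} [a B a1 oB|a b B a2 ba bB IH] M N S f p bfS Saf cp pf pB.
  have [fiso ext] := bfS _ _ Saf; have cfp := condition_gcomp fiso cp.
  have bpB : baire_property (orbit B N).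
    exact: baire_orbit (Sigma0_open kappa a1 oB).
  have [//|[q [cq pq qB]]] := forces_or kappa_card kappa_lt bpB cfp.
  have [h [bh qh Bh]] := forces_ex kappa_card kappa_lt cq qB.
  have [D [sD DB]] := open_set_type_local oB Bh.
  (* Adding [h] on [D] turns [q] into a condition that decides [B] outright. *)
  pose q' := q `|` (fun d => (d, h d)) @` D.
  have cq' : condition q'.
    apply: (condition_graph bh); first by rewrite subUset; split=> // _ [d _ <-].
    by apply: small_setU => //; [case: cq|exact: small_image].
  (* Level 1 leaves exactly one round, played at the only element of [a]. *)
  have [x] : exists x : a, True.
    by have [g [k gK kK] _] := ordt_eq_sym a1; exists (g ord0).
  have [g [fg qg Sg]] := ext _ (oseg_lt x) _
    (small_image snd (let: And3 _ _ s := cq' in s)).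
  have [giso _] := bfS _ _ Sg.
  have pr : p `<=` gcomp (ginv g) q'.
    by apply: sub_gcomp_ginv pf fg _; apply: subset_trans pq _ => z; left.
  have cr := condition_gcomp (partial_isomorphism_sym giso) cq'.
  have [k [bk rk nBk]] := forces_ex kappa_card kappa_lt cr (forces_sub pr pB).
  (* On [D], [k] is [h] followed by the inverse of the partial isomorphism [g], so [act k M] agrees
     there with [act h N]. *)
  case: nBk; apply: DB => R t tD; rewrite !act_val//.
  apply: iff_sym; case: giso => _ _; apply=> j /=.
  have q'j : q' (t j, h (t j)) by right; exists (t j).
  have [|_ [[y z] gyz /= zE]] := qg (h (t j)); first by exists (t j, h (t j)).
  rewrite {}zE in gyz; suff -> : k (t j) = y by [].
  by apply: (rk (t j, y)); exists (h (t j)).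
have [fiso ext] := bfS _ _ Saf; have cfp := condition_gcomp fiso cp.
have bpB i : baire_property (orbit (B i) N).
  rewrite -[orbit _ _]setCK.
  exact: baire_property_setC (baire_orbit N (bB i)).
have bpU : baire_property (orbit (\bigcup_i B i) N).
  exact: (@baire_property_bigcup _ _ _ (fun i => orbit (B i) N)).
have [//|[q [cq pq qB]]] := forces_or kappa_card kappa_lt bpU cfp.
have [i [q' [cq' qq' q'B]]] := @forces_bigcup _ kappa_card kappa_lt q
  (fun i => orbit (B i) N) bpB cq qB.
have [_ bia] := ba i.
have [g [fg qg Sg]] := ext _ bia _
  (small_image snd (let: And3 _ _ s := cq' in s)).
have [giso _] := bfS _ _ Sg.
have pr : p `<=` gcomp (ginv g) q'.
  by apply: sub_gcomp_ginv pf fg _; exact: subset_trans qq'.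
have cr := condition_gcomp (partial_isomorphism_sym giso) cq'.
(* The induction hypothesis concerns the complement of [B i]; it is applied with [M] and [N]
   exchanged, along the inverse of [g]. *)
have rB : forces (gcomp (ginv g) q') (orbit (~` ~` B i) M).
  apply: (IH i N M (fun a f => S a (ginv f)) (ginv g) q').
  - exact: back_and_forth_sym.
  - by rewrite ginvK.
  - by [].
  - by move=> y /qg[_ [[x z] gxz /= <-]]; exists (z, x).
  - by rewrite setCK.
have [h [bh rh [Bh nBh]]] := baire kappa_card kappa_lt cr
  (comeagerI kappa_card kappa_lt rB (forces_sub pr pB)).
case: (nBh rh); exists i => //; apply: contrapT; exact: Bh rh.
Qed.

End Topology.

(** * The game and back-and-forth systems *)

Section Tree.
Variable a : ordType.
Implicit Types p q : Tr a.

Lemma sorted_rcons2 (w : seq a) x y : sorted (fun x y => wlt y x) (rcons w x) ->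
  wlt y x -> sorted (fun x y => wlt y x) (rcons (rcons w x) y).
Proof.
by case: w => [|z w] /=; rewrite ?andbT// => wx yx;
  rewrite rcons_path wx last_rcons.
Qed.

Lemma tsucc_rcons p q y : val q = rcons (val p) y -> tsucc p q.
Proof.
move=> qE; split.
  split; first by exists [:: y]; rewrite cats1.
  move=> pq; move: qE; rewrite pq => /(congr1 size).
  by rewrite size_rcons => /n_Sn.
move=> [r [[[u rE] pr] [[v q_rE] rq]]].
have : size (u ++ v) = 1.
  move/(congr1 size): q_rE; rewrite qE rE !size_cat size_rcons -addn1 -addnA.
  by move=> /addnI ->.
case: u => [|c [|//]] in rE *.
  by move=> _; apply: pr; apply: val_inj; rewrite rE cats0.
case: v => // in q_rE * => _.
by apply: rq; apply: val_inj; rewrite q_rE cats0.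
Qed.

Lemma leaf_rcons p w x : val p = rcons w x -> (forall y, ~ wlt y x) -> leaf p.
Proof.
move=> pE nx [q [[[u qE] pq] _]]; case: u => [|y u] in qE.
  by apply: pq; apply: val_inj; rewrite qE cats0.
have := valP q; rewrite qE pE -cats1 -catA /= => /cat_sorted2[_ /=].
by case/andP => /nx.
Qed.

End Tree.

Section Game.
Variables (kappa : ordType) (L : language).
Hypothesis kappa_card : infinite_cardinal kappa.
Hypothesis kappa_lt : [set: short_seq kappa] #= [set: kappa].
Variables M N : Mod kappa L.

Notation small A := (card_lt A [set: kappa]).

(** II restricts the isomorphism to the pairs with a component in I's last set. These sets increase,
    so the answers do too. *)
Lemma isomorphic_II_wins t : isomorphic M N -> II_wins_EF t M N.
Proof.
case=> h bh hMN; have [k hK kK] := bh.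
pose f (C : set kappa) : set (kappa * kappa) :=
  [set xy | h xy.1 = xy.2 /\ (C xy.1 \/ C xy.2)].
exists (fun s => f (last (troot t, set0) s).2) => s s_legal.
have answerE n : (n < size s)%N ->
    answer (fun s => f (last (troot t, set0) s).2) s n = f (nthI s n).2.
  move=> ns; rewrite /answer /nthI (last_nth (troot t, set0)) size_take_min.
  by rewrite (minn_idPl ns) /= nth_take.
split=> [n ns|_].
  have [_ sC monoC] := s_legal n ns; rewrite answerE//; split.
  - by move=> x y y' [/= <- _] [/= <- _].
  - apply: small_sub (small_setU kappa_card kappa_lt sC (small_image k sC)).
    move=> _ [[x y] [/= <- [Cx|Cx]] <-]; [by left|right; exists (h x) => //].
  - move=> x Cx; split; first by exists (x, h x) => //; split=> //; left.
    by exists (k x, x) => //; split; [exact: kK|right].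
  - move=> i i_n; rewrite answerE//; last exact: ltn_trans ns.
    by move=> [x y] [/= hxy [Cx|Cy]]; split=> //;
      [left|right]; apply: monoC i_n _ _.
split.
- move=> x y y' [n /= ns +] [m /= ms]; rewrite !answerE//.
  by move=> [/= <- _] [/= <- _].
- move=> x x' y [n /= ns +] [m /= ms]; rewrite !answerE//.
  by move=> [/= <- _] [/= /esym/(bij_inj bh) -> _].
- move=> R u v uv; rewrite hMN (_ : h \o u = v)//; apply/funext => j.
  by have [n /= ns] := uv j; rewrite answerE// => -[].
Qed.

Section Strategy.
Variables (a : ordType) (sigma : strategyII kappa (Tr a)).
Hypothesis sigma_wins : winningII M N sigma.

Let root := troot (Tr a).
Let last_node (s : seq (moveI kappa (Tr a))) : Tr a := last root (map fst s).

(** Player I appends [y] to the descending sequence and enlarges the last set by [C]; that set is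
    empty before the first round. *)
Lemma legalI_rcons s (q : Tr a) y C :
  legalI s -> val q = rcons (val (last_node s)) y -> small C ->
  legalI (rcons s (q, C `|` (last (root, set0) s).2)).
Proof.
move=> s_legal qE sC n; rewrite size_rcons ltnS leq_eqVlt => /predU1P[->{n}|ns].
  have nodeE : (if size s is m.+1 then
      (nthI (rcons s (q, C `|` (last (root, set0) s).2)) m).1 else root)
      = last_node s.
    rewrite /last_node /nthI; case/lastP: s {s_legal qE} => //= s z.
    by rewrite size_rcons nth_rcons size_rcons ltnSn nth_rcons ltnn eqxx
               map_rcons last_rcons.
  rewrite nodeE /nthI nth_rcons ltnn eqxx /=; split.
  - exact: tsucc_rcons qE.
  - apply: small_setU => //.
    case/lastP: s s_legal {qE nodeE} => [_|s z s_legal]; first exact: small0.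
    have [|_ + _] := s_legal (size s); first by rewrite size_rcons.
    by rewrite /nthI nth_rcons ltnn eqxx last_rcons.
  - move=> i i_s; rewrite nth_rcons i_s => x Cx; right.
    case/lastP: s s_legal i_s Cx {qE nodeE} => // s z s_legal.
    rewrite size_rcons ltnS leq_eqVlt last_rcons nth_rcons.
    move=> /predU1P[->|i_s]; first by rewrite ltnn eqxx.
    rewrite i_s; have [|_ _ /(_ i i_s x)] := s_legal (size s).
      by rewrite size_rcons.
    by rewrite /nthI !nth_rcons ltnn eqxx i_s.
have [tn sn Cn] := s_legal n ns; rewrite /nthI nth_rcons ns; split=> //.
  by case: n ns tn {sn Cn} => // n ns; rewrite nth_rcons (ltnW ns).
by move=> i i_n; rewrite nth_rcons (ltn_trans i_n ns); exact: Cn.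
Qed.

(** The value of [sigma] at the empty run is no answer of II, whence the guard [s <> [::]]. *)
Lemma strategy_extends s y C : legalI s -> small C ->
  sorted (fun x y => wlt y x) (rcons (val (last_node s)) y) ->
  exists s', [/\ legalI s', s' <> [::],
    val (last_node s') = rcons (val (last_node s)) y,
    s <> [::] -> sigma s `<=` sigma s'
  & C `<=` gdom (sigma s') `&` gran (sigma s')].
Proof.
move=> s_legal sC y_sorted.
pose q : Tr a :=
  exist (fun s : seq a => sorted (fun x y => wlt y x) s) _ y_sorted.
have s'_legal := @legalI_rcons s q y C s_legal erefl sC.
exists (rcons s (q, C `|` (last (root, set0) s).2)).
have [|_ _ Cn mono] := (sigma_wins s'_legal).1 (size s).
  by rewrite size_rcons.
have sE : answer sigma (rcons s (q, C `|` (last (root, set0) s).2)) (size s) =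
    sigma (rcons s (q, C `|` (last (root, set0) s).2)).
  by rewrite /answer take_oversize// size_rcons.
rewrite sE in Cn mono; split=> //.
- by move=> /(congr1 size); rewrite size_rcons.
- by rewrite /last_node map_rcons last_rcons.
- move=> s0; have s_gt0 : (0 < size s)%N by case: (s) s0.
  have := mono (size s).-1; rewrite /answer prednK// => /(_ (leqnn _)).
  by rewrite -cats1 take_size_cat.
- move=> x Cx; apply: Cn; rewrite /nthI nth_rcons ltnn eqxx /=.
  by left.
Qed.

(** Winning is judged only at the end of a run, so I keeps descending until no smaller ordinal is
    left; the final answer contains the present one. *)
Lemma strategy_partial_isomorphism x s w : legalI s -> s <> [::] ->
  val (last_node s) = rcons w x -> partial_isomorphism M N (sigma s).
Proof.
elim/wlt_ind: x s w => x IH s w s_legal s0 sE.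
have [[y yx]|nx] := pselect (exists y, wlt y x).
  have [||s' [s'_legal s'0 s'E ss' _]] := @strategy_extends s y set0 s_legal.
  - exact: small0.
  - by rewrite sE; apply: sorted_rcons2 yx; rewrite -sE; exact: valP.
  apply: partial_isomorphismS (ss' s0) _.
  by apply: IH yx _ _ s'_legal s'0 s'E.
have over : game_over s.
  by apply: (@leaf_rcons a (last_node s) w x sE) => y yx; apply: nx; exists y.
have [_ /(_ over)] := sigma_wins s_legal; apply: partial_isomorphismS.
case/lastP: (s) s0 => // s' z _ xy sxy; exists (size s').
  by rewrite /= size_rcons.
by rewrite /answer take_oversize// size_rcons.
Qed.

(* II's answer after I's descending sequence has reached [x] has rank [x]. *)
Definition strategy_rank (b : ordType) (f : set (kappa * kappa)) :=
  (exists s w x, [/\ legalI s, s <> [::], val (last_node s) = rcons w x,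
     ordt_eq b (oseg x) & f = sigma s]) \/ (ordt_eq b a /\ f = set0).

Lemma strategy_back_and_forth : a -> back_and_forth M N strategy_rank.
Proof.
move=> x0.
have legal0 : @legalI kappa (Tr a) [::] by [].
have start x C : small C -> exists s, [/\ legalI s, s <> [::],
    val (last_node s) = rcons [::] x
  & C `<=` gdom (sigma s) `&` gran (sigma s)].
  move=> sC.
  by have [//|s []] := @strategy_extends [::] x C legal0 sC; exists s.
move=> b f [[s [w [x [s_legal s0 sE bx ->]]]]|[ba ->]]; split.
- exact: strategy_partial_isomorphism s_legal s0 sE.
- move=> c cb C sC; have [y yx cy] := ordt_lt_oseg (ordt_lt_eqr cb bx).
  have [|s' [s'_legal s'0 s'E ss' Cs']] := @strategy_extends s y C s_legal sC.
    by rewrite sE; apply: sorted_rcons2 yx; rewrite -sE; exact: valP.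
  exists (sigma s'); split=> //; first exact: ss'.
  by left; exists s', (val (last_node s)), y.
(* Nullary symbols make this a genuine condition on the empty map; it is inherited from II's answer
   to a first move at [x0]. *)
- have [s [s_legal s0 sE _]] := start x0 set0 (small0 kappa_card kappa).
  by apply: partial_isomorphismS (strategy_partial_isomorphism s_legal s0 sE).
- move=> c /ordt_lt_eqr/(_ ba)[y cy] C sC.
  have [s [s_legal s0 sE Cs]] := start y C sC.
  by exists (sigma s); split=> //; left; exists s, [::], y.
Qed.

End Strategy.
End Game.

(** * Isomorphism from a winning strategy *)

Section Main.
Variables (kappa : ordType) (L : language).
Hypothesis kappa_card : infinite_cardinal kappa.
Hypothesis kappa_lt : [set: short_seq kappa] #= [set: kappa].
Variable K : set (Mod kappa L).
Hypothesis K_inv : iso_invariant K.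

(** The isomorphism class of [M] is the preimage of [iso_rel K] under [Mc]'s map, and every
    bijection acts inside isomorphism classes, so the empty condition decides it. *)
Lemma back_and_forth_isomorphic a S (M N : set_type K) :
  borel_level kappa (iso_rel K) a ->
  back_and_forth (set_val M) (set_val N) S -> S a set0 ->
  isomorphic (set_val M) (set_val N).
Proof.
move=> [_ aB] bfS Sa.
have Mc : continuous (fun N' : set_type K => (M, N')).
  move=> x U /= [[P Q] /= [PM Qx] PQ]; apply: filterS Qx => N' QN'; apply: PQ.
  by split=> //; exact: nbhs_singleton PM.
have forces0 (G : set (kappa -> kappa)) :
    (forall h, bijective h -> G h) -> forces set0 G.
  move=> GT.
  have dT : @dense kappa setT by move=> p cp; exists p; split=> // z.
  by apply: comeagerS (comeager_dense kappa_card dT) => h /GT Gh _ _.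
have c0 : @condition kappa set0 by split=> //; exact: small0.
have g0 : gran (@set0 (kappa * kappa)) `<=` gdom (@set0 (kappa * kappa)).
  by move=> _ [z []].
have f0 : gcomp (@set0 (kappa * kappa)) set0 `<=` set0 by move=> z [y []].
have iso_act h (P : set_type K) : bijective h ->
    isomorphic (set_val (act h P)) (set_val P).
  by move=> bh; rewrite (act_val K_inv)//; exact: isomorphic_pull.
case: aB => /(Sigma0_preimage Mc) aA.
  (* If the class is [Sigma0 a], its complement, forced at [N], is transferred to [M], against
     [act h M] being isomorphic to [M]. *)
  apply: contrapT => nMN.
  have S'a : S a (ginv set0) by rewrite (_ : ginv set0 = set0)//; apply/seteqP.
  have /(forces_sub f0)/(forces_ex kappa_card kappa_lt c0)[h [bh _]] :=
    forces_transfer kappa_card kappa_lt K_inv aA (back_and_forth_sym bfS) S'a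
      c0 g0 (forces0 _ (fun h bh MN =>
        nMN (isomorphic_trans MN (iso_act h N bh)))).
  by apply; exact/isomorphic_sym/iso_act.
(* If the class is [Pi0 a], it is itself transferred from [M] to [N], as a double complement. *)
have /(forces_sub f0)/(forces_ex kappa_card kappa_lt c0)[h [bh _]] :=
  forces_transfer kappa_card kappa_lt K_inv aA bfS Sa
    c0 g0 (forces0 _ (fun h bh nMM => nMM (isomorphic_sym (iso_act h M bh)))).
by move=> /contrapT MN; exact: isomorphic_trans MN (iso_act _ _ bh).
Qed.

End Main.

Theorem theorem4p8 (kappa : ordType) (L : language) (K : set (Mod kappa L))
    (delta0 : ordType)
    (kappa_card : infinite_cardinal kappa)
    (kappa_lt : [set: short_seq kappa] #= [set: kappa])
    (L_le : [set: L] #<= [set: kappa])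
    (K_inv : iso_invariant K)
    (rk_iso : rk_B kappa (iso_rel K) = Rank delta0)
    (M N : Mod kappa L) (KM : K M) (KN : K N) :
  isomorphic M N <-> II_wins_EF (Tr (ordt_max delta0 (ofin 1))) M N.
Proof.
split=> [|[sigma sigma_wins]]; first exact: isomorphic_II_wins.
have [x0 _] := infinite_setN0 (kappa_card.1).
have level := rk_B_level x0 rk_iso.
(* The level is at least 1, so I has a first move. *)
have [d0] : exists d0 : ordt_max delta0 (ofin 1), True.
  have [[[y [f _ _]]|[f _ _]] _] := level; last by exists (f ord0).
  by exists (val (f ord0)).
move=> _.
pose M' : set_type K := exist _ M (mem_set KM).
pose N' : set_type K := exist _ N (mem_set KN).
apply: (@back_and_forth_isomorphic _ _ kappa_card kappa_lt K K_inv _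
  (strategy_rank sigma) M' N' level).
  exact: strategy_back_and_forth sigma_wins d0.
by right; split=> //; exact: ordt_eq_refl.
Qed.
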